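(* Let $K$ be a field of characteristic zero and let $K\langle a,b,c,d\rangle_{\mathrm{rat}}$ be the free skew field over $K$ on four free generators $a,b,c,d$. Put \[ p=C(b,a),\quad q=C(C(a,c),C(a,b)),\quad r=C(C(b,d),C(b,c)),\quad s=C(c,d), \] where $C(y,x)=(y-x)x(y-x)^{-1}$. Then \[ K\langle p,q,r,s\rangle_{\mathrm{rat}}\subsetneq K\langle a,b,c,d\rangle_{\mathrm{rat}}. \] Equivalently, the map $F_{P_4}(a,b,c,d)=(p,q,r,s)$ has no free rational inverse.
   Context: The free skew field $K\langle a,b,c,d\rangle_{\mathrm{rat}}$ is the universal skew field of fractions of the free associative algebra $K\langle a,b,c,d\rangle$, i.e. the skew field of noncommutative rational functions over $K$ in $a,b,c,d$. For elements $p,q,r,s$ of it, $K\langle p,q,r,s\rangle_{\mathrm{rat}}$ denotes the skew subfield generated over $K$ by $p,q,r,s$ (all elements obtained from them and $K$ by rational operations). All the inverses displayed in $p,q,r,s$ exist in the free skew field. A free rational inverse of $F_{P_4}$ is a quadruple of noncommutative rational expressions over $K$ in four variables which, evaluated at $(p,q,r,s)$, are defined and return $(a,b,c,d)$. *)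

(* Defs.v *)
From mathcomp Require Import all_boot all_algebra.
From mathcomp Require Import monalg.

Set Implicit Arguments.
Unset Strict Implicit.
Unset Printing Implicit Defensive.

Import GRing.Theory.
Local Open Scope ring_scope.

(* The algebra of the free monoid of words on n letters. *)
Notation freeAlg K n := {malg K[{fmonom 'I_n}]}.

Definition freeConst (K : fieldType) n (c : K) : freeAlg K n := c%:MP.

Definition freeVar (K : fieldType) n (i : 'I_n) : freeAlg K n := << fmu i >>.

(* A skew field is a unitRingType (not assumed commutative, and with 1 != 0)
   in which every nonzero element is a unit. *)
Definition skew_field (D : unitRingType) : Prop := GRing.field_axiom D.

(* Membership in the smallest skew subfield of D containing S.  When D is a
   skew field, divring_closed P says that P is a skew subfield: closure under
   x / y at y = 0 is harmless since 0^-1 = 0. *)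
Definition in_skew_subfield (D : unitRingType) (S : D -> Prop) (x : D) : Prop :=
  forall P : {pred D}, divring_closed P -> (forall y, S y -> y \in P) -> x \in P.

(* Universal fields of fractions, following P. M. Cohn.  An R-field is a skew
   field U with a ring morphism f : R -> U; it is epic when it is generated, as
   a skew field, by the image of R. *)
Definition epic_Rfield (R : nzRingType) (U : unitRingType)
    (f : {rmorphism R -> U}) : Prop :=
  skew_field U /\
  (forall x : U, in_skew_subfield (fun y => exists r : R, y = f r) x).

(* A specialization of R-fields from U to L: an R-ring morphism phi to L from
   an R-subring U0 of U, in which all elements outside ker phi are invertible.
   The values of phi outside U0 are irrelevant. *)
Definition specialization (R : nzRingType) (U L : unitRingType)
    (f : {rmorphism R -> U}) (g : {rmorphism R -> L})
    (U0 : {pred U}) (phi : U -> L) : Prop :=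
  [/\ subring_closed U0,
      forall r : R, f r \in U0 /\ phi (f r) = g r,
      {in U0 &, {morph phi : x y / x - y}},
      {in U0 &, {morph phi : x y / x * y}}
    & {in U0, forall x, phi x != 0 -> x^-1 \in U0}].

(* The uniqueness (up to restriction) of the specialization is automatic for
   epic R-fields. *)
Definition universal_Rfield (R : nzRingType) (U : unitRingType)
    (f : {rmorphism R -> U}) : Prop :=
  epic_Rfield f /\
  (forall (L : unitRingType) (g : {rmorphism R -> L}), epic_Rfield g ->
    exists (U0 : {pred U}) (phi : U -> L), specialization f g U0 phi).

Definition universal_field_of_fractions (R : nzRingType) (U : unitRingType)
    (f : {rmorphism R -> U}) : Prop :=
  universal_Rfield f /\ injective f.

(* D, with the embedding f of the free algebra, is the free skew field over K
   on the n free generators f (freeVar K i). *)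
Definition free_skew_field (K : fieldType) (n : nat) (D : unitRingType)
    (f : {rmorphism freeAlg K n -> D}) : Prop :=
  universal_field_of_fractions f.

(* Noncommutative rational expressions over K in n variables. *)
Inductive ratexpr (K : Type) (n : nat) : Type :=
  | RConst of K
  | RVar of 'I_n
  | ROpp of ratexpr K n
  | RAdd of ratexpr K n & ratexpr K n
  | RMul of ratexpr K n & ratexpr K n
  | RInv of ratexpr K n.

(* Evaluation at v, with k interpreting the constants; None means that the
   expression is undefined at v (some inverted subexpression is not a unit). *)
Fixpoint reval (K : Type) (n : nat) (D : unitRingType) (k : K -> D)
    (v : n.-tuple D) (e : ratexpr K n) : option D :=
  match e with
  | RConst c => Some (k c)
  | RVar i => Some (tnth v i)
  | ROpp e1 => omap -%R (reval k v e1)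
  | RAdd e1 e2 =>
      if (reval k v e1, reval k v e2) is (Some x, Some y)
      then Some (x + y) else None
  | RMul e1 e2 =>
      if (reval k v e1, reval k v e2) is (Some x, Some y)
      then Some (x * y) else None
  | RInv e1 =>
      if reval k v e1 is Some x
      then if x \is a GRing.unit then Some x^-1 else None
      else None
  end.

Definition C (D : unitRingType) (y x : D) : D := (y - x) * x * (y - x)^-1.

(* Main.v *)
From Stdlib Require Import Ncring Ncring_tac.
Require Import Defs.
From HB Require Import structures.
From mathcomp Require Import all_boot all_algebra.
From mathcomp Require Import perm monalg boolp generic_quotient.
Set Implicit Arguments.
Unset Strict Implicit.
Unset Printing Implicit Defensive.
Import GRing.Theory.
Local Open Scope ring_scope.
Local Open Scope quotient_scope.

(** Write a, b, c, d for the generators of the free skew field D, and x_y for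
    C y x.  If delta : D -> D is additive and satisfies
    delta (x * y) = delta x * sigma y + x * delta y for a ring endomorphism
    sigma of D, then the kernel of delta is a skew subfield of D
    ([kernel_divring_closed]).  So it is enough to find such a sigma-derivation
    that kills K, p, q, r and s, but not c ([derivation_exists]); both halves of
    the theorem follow, because a rational expression in elements of a skew
    subfield takes its value there ([reval_in]).

    Where delta comes from.  The differential of (p, q, r, s), with coefficients
    evaluated at the generators on the left of an increment and at their images
    under sigma on the right, is a 4 x 4 matrix with entries in D tensor D^op.
    At commuting points it is invertible when sigma = 1, but it is singular for
    suitable other sigma.  Take delta a = delta b = 0, which settles p.  Since
    c_a is determined by c_a (c - a) = (c - a) c, it does not move either, provided
    that sigma c = a and delta c = c - a: this is a resonance between c and a,
    and it settles q.  The choice sigma d = 2 c - a, delta d = sigma d - d settles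
    s.  Finally n = (c_d - b_d) (c - d) conjugates c into r, that is r n = n c, so
    delta r = 0 as soon as delta n = n, and this last equation determines
    sigma b rationally.  The value of sigma a is still free.  The
    computations are in the section [Fibre].

    Why sigma and delta exist on all of D.  Prescribing values on the generators
    gives a map on the free algebra R only, and the universal property of D
    extends a map from R to a skew field Y only to a place of D, undefined on
    some elements.  It is an everywhere defined morphism as soon as some place
    leads back from Y and turns the images of the generators into the
    generators themselves ([extend]): an element sent to 0 by the first place
    would be sent to 0 by the identity.  The places back are residue maps of
    fields of skew Laurent series D((t; tau)), where t x = tau x * t.

    - For delta ([twisted_derivation]), map each generator x to
      x + (delta x) t in D((t; sigma)); at t = 0 one recovers x, and delta is the
      coefficient of t.

    - For sigma ([twist_exists]), one needs a degenerate point at which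
      (sigma a, sigma b, sigma c, sigma d) specializes to (a, b, c, d).  The
      equation sigma b = given is not rationally solvable in b, because b
      enters through b_d; but in the limit d = 0 one has b_d = b and the
      equation becomes linear in b.  The price is that d is lost, and this is
      why sigma a := d a d^-1 is chosen: with d = t in D((t; pi)), where pi
      exchanges a and c, the conjugate of c by t is the independent generator
      pi c = a ([degenerate_place]). *)

(** * Skew power series *)

(** Power series in t with coefficients on the left and t x = sigma x * t; the
    endomorphism is a parameter of the type because the product depends on it. *)
Definition series (D : nzRingType) (sigma : {rmorphism D -> D}) : Type :=
  nat -> D.

HB.instance Definition _ D sigma := gen_eqMixin (@series D sigma).
HB.instance Definition _ D sigma := gen_choiceMixin (@series D sigma).

Section SeriesRing.
Variables (D : nzRingType) (sigma : {rmorphism D -> D}).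
Local Notation O := (series sigma).
Implicit Types x y z : O.

Definition ser_zero : O := fun _ => 0.
Definition ser_opp x : O := fun n => - x n.
Definition ser_add x y : O := fun n => x n + y n.
Definition ser_one : O := fun n => (n == 0%N)%:R.
Definition ser_mul x y : O :=
  fun n => \sum_(i < n.+1) x i * iter i sigma (y (n - i)%N).

Fact ser_addA : associative ser_add.
Proof. by move=> x y z; apply: funext => n; apply: addrA. Qed.
Fact ser_addC : commutative ser_add.
Proof. by move=> x y; apply: funext => n; apply: addrC. Qed.
Fact ser_add0 : left_id ser_zero ser_add.
Proof. by move=> x; apply: funext => n; apply: add0r. Qed.
Fact ser_addN : left_inverse ser_zero ser_opp ser_add.
Proof. by move=> x; apply: funext => n; apply: addNr. Qed.

HB.instance Definition _ := GRing.isZmodule.Build O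
  ser_addA ser_addC ser_add0 ser_addN.

Lemma ser_coefD x y n : (x + y) n = x n + y n. Proof. by []. Qed.
Lemma ser_coefN x n : (- x) n = - x n. Proof. by []. Qed.

Lemma iter_rmorph_sum i n (F : 'I_n -> D) (P : pred 'I_n) :
  iter i sigma (\sum_(k < n | P k) F k) = \sum_(k < n | P k) iter i sigma (F k).
Proof. by elim: i => //= i ->; rewrite rmorph_sum. Qed.

Lemma iter_rmorphM i u v : iter i sigma (u * v) = iter i sigma u * iter i sigma v.
Proof. by elim: i => //= i ->; rewrite rmorphM. Qed.

Lemma iter_rmorphD i u v : iter i sigma (u + v) = iter i sigma u + iter i sigma v.
Proof. by elim: i => //= i ->; rewrite rmorphD. Qed.

Lemma iter_rmorph0 i : iter i sigma 0 = 0.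
Proof. by elim: i => //= i ->; rewrite rmorph0. Qed.

Lemma iter_rmorph1 i : iter i sigma 1 = 1.
Proof. by elim: i => //= i ->; rewrite rmorph1. Qed.

(** Indexing the second factor from the low end makes the two ways of expanding
    a triple product range over the same triangle of indices. *)
Fact ser_mul_rev x y n :
  ser_mul x y n = \sum_(i < n.+1) x (n - i)%N * iter (n - i) sigma (y i).
Proof.
rewrite /ser_mul (reindex_inj rev_ord_inj) /=.
by apply: eq_bigr => i _; rewrite subSS subKn // -ltnS.
Qed.

Fact ser_mulA : associative ser_mul.
Proof.
move=> x y z; apply: funext => i; rewrite [RHS]ser_mul_rev /=.
pose coef3 j k :=
  x j * iter j sigma (y (i - j - k)%N) * iter (i - k) sigma (z k).
transitivity (\sum_(j < i.+1) \sum_(k < i.+1 | (k <= i - j)%N) coef3 j k).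
  apply: eq_bigr => /= j _; rewrite ser_mul_rev iter_rmorph_sum big_distrr /=.
  rewrite (big_ord_narrow_leq (leq_subr _ _)); apply: eq_bigr => k _ /=.
  have ji : (j <= i)%N by rewrite -ltnS.
  have kij : (k <= i - j)%N by rewrite -ltnS.
  rewrite /coef3 iter_rmorphM mulrA; congr (_ * _).
  by rewrite -iterD addnBA // subnKC.
rewrite (exchange_big_dep predT) //=; apply: eq_bigr => k _.
transitivity (\sum_(j < i.+1 | (j <= i - k)%N) coef3 j k).
  apply: eq_bigl => j; rewrite -ltnS -(ltnS j) -!subSn ?leq_ord //.
  by rewrite -subn_gt0 -(subn_gt0 j) -!subnDA addnC.
rewrite (big_ord_narrow_leq (leq_subr _ _)) big_distrl /=.
by apply: eq_bigr => j _; rewrite /coef3 -!subnDA addnC.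
Qed.

Fact ser_mul1l : left_id ser_one ser_mul.
Proof.
move=> x; apply: funext => n; rewrite /ser_mul big_ord_recl subn0 mul1r.
by rewrite big1 ?addr0 // => i _; rewrite mul0r.
Qed.

Fact ser_mul1r : right_id ser_one ser_mul.
Proof.
move=> x; apply: funext => n; rewrite /ser_mul big_ord_recr /= subnn.
rewrite iter_rmorph1 mulr1 big1 ?add0r // => i _.
by rewrite /ser_one subn_eq0 leqNgt ltn_ord iter_rmorph0 mulr0.
Qed.

Fact ser_mulDl : left_distributive ser_mul +%R.
Proof.
move=> x y z; apply: funext => n; rewrite [RHS]ser_coefD /ser_mul -big_split.
by apply: eq_bigr => i _; rewrite mulrDl.
Qed.

Fact ser_mulDr : right_distributive ser_mul +%R.
Proof.
move=> x y z; apply: funext => n; rewrite [RHS]ser_coefD /ser_mul -big_split.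
by apply: eq_bigr => i _; rewrite iter_rmorphD mulrDr.
Qed.

Fact ser_1neq0 : ser_one != 0.
Proof.
apply/eqP => /(congr1 (fun x : O => x 0%N)) /eqP.
by rewrite /ser_one eqxx oner_eq0.
Qed.

HB.instance Definition _ := GRing.Zmodule_isNzRing.Build O
  ser_mulA ser_mul1l ser_mul1r ser_mulDl ser_mulDr ser_1neq0.

Lemma ser_coefM x y n :
  (x * y) n = \sum_(i < n.+1) x i * iter i sigma (y (n - i)%N).
Proof. by []. Qed.

Lemma ser_coefM0 x y : (x * y) 0%N = x 0%N * y 0%N.
Proof. by rewrite ser_coefM big_ord_recl big_ord0 addr0. Qed.

Lemma ser_coefM1 x y : (x * y) 1%N = x 0%N * y 1%N + x 1%N * sigma (y 0%N).
Proof. by rewrite ser_coefM !big_ord_recl big_ord0 addr0. Qed.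

Definition serC (u : D) : O := fun n => if n is 0%N then u else 0.
Definition serX : O := fun n => (n == 1%N)%:R.
Definition ser_map x : O := fun n => sigma (x n).

Lemma ser_coefMX x n : (x * serX) n = if n is m.+1 then x m else 0.
Proof.
rewrite ser_coefM; case: n => [|n].
  by rewrite big_ord_recl big_ord0 /serX mulr0 addr0.
rewrite !big_ord_recr /= subnn subSnn /serX /= iter_rmorph0 rmorph0 iter_rmorph1.
rewrite mulr0 addr0 mulr1 big1 ?add0r // => i _.
have ni : (i < n)%N := ltn_ord i.
by rewrite (subSn (ltnW ni)) eqSS subn_eq0 leqNgt ni iter_rmorph0 mulr0.
Qed.

Lemma ser_coefXM x n : (serX * x) n = if n is m.+1 then sigma (x m) else 0.
Proof.
rewrite ser_coefM; case: n => [|n].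
  by rewrite big_ord_recl big_ord0 /serX mul0r addr0.
rewrite big_ord_recl mul0r add0r big_ord_recl /= mul1r subSS subn0.
by rewrite big1 ?addr0 // => i _; rewrite mul0r.
Qed.

Lemma ser_coefCM u x n : (serC u * x) n = u * x n.
Proof.
rewrite ser_coefM big_ord_recl subn0 big1 ?addr0 // => i _.
by rewrite mul0r.
Qed.

Lemma ser_coefMC u x n : (x * serC u) n = x n * iter n sigma u.
Proof.
rewrite ser_coefM big_ord_recr /= subnn big1 ?add0r // => i _.
by rewrite /serC; case: (n - i)%N (subn_gt0 i n) => [|m];
  rewrite ?ltn_ord // iter_rmorph0 mulr0.
Qed.

Fact serC_zmod : zmod_morphism serC.
Proof.
by move=> u v; apply: funext => -[|n] //; rewrite ser_coefD ser_coefN /= subr0.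
Qed.

Fact serC_monoid : monoid_morphism serC.
Proof.
split=> [|u v]; apply: funext => -[|n] //; first exact: esym (ser_coefCM u (serC v) 0).
by rewrite [RHS]ser_coefCM mulr0.
Qed.

HB.instance Definition _ := GRing.isZmodMorphism.Build D O serC serC_zmod.
HB.instance Definition _ := GRing.isMonoidMorphism.Build D O serC serC_monoid.

Fact ser_map_zmod : zmod_morphism ser_map.
Proof. by move=> x y; apply: funext => n; apply: rmorphB. Qed.

Lemma iterSC i u : sigma (iter i sigma u) = iter i sigma (sigma u).
Proof. by rewrite -iterS iterSr. Qed.

Fact ser_map_monoid : monoid_morphism ser_map.
Proof.
split; first by apply: funext => n; apply: rmorph_nat.
move=> x y; apply: funext => n; rewrite /ser_map !ser_coefM rmorph_sum.
by apply: eq_bigr => i _; rewrite rmorphM iterSC.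
Qed.

HB.instance Definition _ := GRing.isZmodMorphism.Build O O ser_map ser_map_zmod.
HB.instance Definition _ := GRing.isMonoidMorphism.Build O O ser_map ser_map_monoid.

Lemma serXM x : serX * x = ser_map x * serX.
Proof. by apply: funext => n; rewrite ser_coefXM ser_coefMX. Qed.

Lemma serX_C u : serX * serC u = serC (sigma u) * serX.
Proof.
rewrite serXM; congr (_ * _); apply: funext => -[|n] //; exact: rmorph0.
Qed.

End SeriesRing.

Section SeriesUnits.
Variables (D : unitRingType) (sigma : {rmorphism D -> D}).
Hypothesis Dfield : skew_field D.
Local Notation O := (series sigma).
Implicit Types x y : O.

Let mulVf (u : D) : u != 0 -> u^-1 * u = 1.
Proof. by move/Dfield/mulVr. Qed.
Let mulfV (u : D) : u != 0 -> u * u^-1 = 1.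
Proof. by move/Dfield/mulrV. Qed.

(** The coefficients of a right inverse obey a recursion that uses all the
    previous ones; the table [inv_approx x n] is correct up to index n. *)
Fixpoint inv_approx x n : nat -> D :=
  if n is m.+1 then fun k =>
    if (k <= m)%N then inv_approx x m k else
    - ((x 0%N)^-1 *
       \sum_(i < m.+1) x i.+1 * iter i.+1 sigma (inv_approx x m (m - i)%N))
  else fun _ => (x 0%N)^-1.

Lemma inv_approx_stable x n k : (k <= n)%N -> inv_approx x n k = inv_approx x k k.
Proof.
elim: n => [|n IHn]; first by case: k.
by rewrite leq_eqVlt ltnS => /predU1P[-> // | /[dup] kn /IHn <-] /=; rewrite kn.
Qed.

Lemma series_rinv x : x 0%N != 0 -> exists y, x * y = 1.
Proof.
move=> x0; exists (fun n => inv_approx x n n); apply: funext => -[|n].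
  by rewrite ser_coefM big_ord_recl big_ord0 addr0 /= mulfV.
rewrite ser_coefM big_ord_recl subn0 /= ltnn mulrN mulrA mulfV // mul1r.
apply/eqP; rewrite addrC subr_eq0; apply/eqP/eq_bigr => i _.
by rewrite subSS [in RHS]inv_approx_stable ?leq_subr.
Qed.

Lemma series_inv x : x 0%N != 0 -> exists y, y * x = 1 /\ x * y = 1.
Proof.
move=> x0; have [y xy1] := series_rinv x0.
(* A right inverse of x again has a right inverse, which must be x. *)
exists y; split=> //.
have /series_rinv[z yz1] : y 0%N != 0.
  apply: contra_eq_neq (congr1 (fun z : O => z 0%N) xy1) => y0.
  by rewrite ser_coefM0 y0 mulr0 eq_sym oner_neq0.
by rewrite -[x]mulr1 -yz1 (mulrA x) xy1 mul1r.
Qed.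

Lemma ser_coefMXn x n k :
  (x * serX sigma ^+ n) k = if (k < n)%N then 0 else x (k - n)%N.
Proof.
elim: n k => [|n IHn] k; first by rewrite expr0 mulr1 subn0.
by rewrite exprSr mulrA ser_coefMX; case: k => [|k] //; rewrite IHn.
Qed.

Lemma series_factor x :
  x != 0 -> exists (u : O) n, u 0%N != 0 /\ x = u * serX sigma ^+ n.
Proof.
move=> x0; have exn : exists n, x n != 0.
  apply: contra_neqP x0 => x_n; apply: funext => n.
  by apply/eqP/negbNE/negP => xn; apply: x_n; exists n.
case: (ex_minnP exn) => n xn n_min; exists (fun k => x (k + n)%N), n.
split=> //; apply: funext => k; rewrite ser_coefMXn.
case: ltnP => [kn | nk]; last by rewrite subnK.
by apply/eqP/negbNE/negP => /n_min; rewrite leqNgt kn.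
Qed.

(** The source is a skew field, so every nonzero element is sent to a unit. *)
Lemma rmorph_skew_inj : injective sigma.
Proof.
apply: raddf_inj => u /eqP; apply: contraTeq => u0.
apply/eqP => su0; have /eqP := congr1 sigma (mulfV u0).
by rewrite rmorphM rmorph1 su0 mul0r eq_sym oner_eq0.
Qed.

Lemma serX_reg x : serX sigma * x = 0 -> x = 0.
Proof.
move=> tx0; apply: funext => n; apply: rmorph_skew_inj.
by rewrite [RHS]rmorph0 -(ser_coefXM x n.+1) tx0.
Qed.

End SeriesUnits.

(** * Inverting the variable *)

(** The data that allow fractions t^-n x: moving t to the left across x costs an
    endomorphism, which need not be surjective.  This is why t is inverted on
    the left only. *)
Record twist (O : nzRingType) := Twist {
  tw_map : {rmorphism O -> O};
  tw_var : O;
  tw_comm : forall x, tw_var * x = tw_map x * tw_var;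
  tw_fix : tw_map tw_var = tw_var;
  tw_reg : forall x, tw_var * x = 0 -> x = 0
}.

Section Localization.
Variables (O : nzRingType) (w : twist O).
Local Notation t := (tw_var w).
Local Notation S := (tw_map w).

Lemma tw_expr_reg n x : t ^+ n * x = 0 -> x = 0.
Proof. by elim: n => [|n IHn]; rewrite ?mul1r // exprS -mulrA => /tw_reg. Qed.

Lemma tw_expr_inj n : injective ( *%R (t ^+ n)).
Proof.
move=> x y /eqP; rewrite -subr_eq0 -mulrBr => /eqP/tw_expr_reg/eqP.
by rewrite subr_eq0 => /eqP.
Qed.

Lemma tw_expr_comm n x : t ^+ n * x = iter n S x * t ^+ n.
Proof.
elim: n => [|n IHn]; first by rewrite mul1r mulr1.
by rewrite exprS -mulrA IHn mulrA tw_comm -mulrA.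
Qed.

Lemma tw_iterX m n : iter m S (t ^+ n) = t ^+ n.
Proof. by elim: m => //= m ->; rewrite rmorphXn /= tw_fix. Qed.

Lemma tw_iterM m x y : iter m S (x * y) = iter m S x * iter m S y.
Proof. by elim: m => //= m ->; rewrite rmorphM. Qed.

Lemma tw_iterD m x y : iter m S (x + y) = iter m S x + iter m S y.
Proof. by elim: m => //= m ->; rewrite rmorphD. Qed.

Lemma tw_exprC m n x : t ^+ m * (t ^+ n * x) = t ^+ n * (t ^+ m * x).
Proof. by rewrite !mulrA -!exprD addnC. Qed.

(** The pair (n, x) stands for t^-n x. *)
Definition eqf (u v : nat * O) := t ^+ v.1 * u.2 == t ^+ u.1 * v.2.

Fact eqf_refl : reflexive eqf. Proof. by move=> u; apply: eqxx. Qed.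
Fact eqf_sym : symmetric eqf. Proof. by move=> u v; apply: eq_sym. Qed.
Fact eqf_trans : transitive eqf.
Proof.
move=> [n y] [m x] [k z]; rewrite /eqf /= => /eqP xy /eqP yz.
apply/eqP/(@tw_expr_inj n); rewrite /= mulrA -exprD addnC exprD -mulrA xy.
by rewrite mulrA -exprD addnC exprD -mulrA yz mulrA -exprD addnC exprD mulrA.
Qed.

Canonical eqf_equiv := EquivRel eqf eqf_refl eqf_sym eqf_trans.

Definition loc : Type := {eq_quot eqf}.
HB.instance Definition _ := Choice.on loc.
HB.instance Definition _ := EqQuotient.on loc.

Definition frac (n : nat) (x : O) : loc := \pi_loc (n, x).

Lemma fracP n x m y : (frac n x = frac m y) <-> (t ^+ m * x = t ^+ n * y).
Proof.
rewrite /frac; split=> [/eqP|E]; first by rewrite piE => /eqP.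
by apply/eqP; rewrite piE; apply/eqP.
Qed.

Lemma frac_ind (P : loc -> Prop) : (forall n x, P (frac n x)) -> forall u, P u.
Proof. by move=> Pf u; rewrite -[u]reprK; case: (repr u) => n x; apply: Pf. Qed.

Lemma frac_shift k n x : frac n x = frac (k + n) (t ^+ k * x).
Proof. by apply/fracP; rewrite exprD -mulrA tw_exprC. Qed.

Lemma frac_common (u v : loc) : exists n x y, u = frac n x /\ v = frac n y.
Proof.
elim/frac_ind: u => n x; elim/frac_ind: v => m y.
exists (m + n)%N, (t ^+ m * x), (t ^+ n * y).
by rewrite -frac_shift addnC -frac_shift.
Qed.

Lemma frac_common3 (u v z : loc) :
  exists n x y z', [/\ u = frac n x, v = frac n y & z = frac n z'].
Proof.
have [n [x [y [-> ->]]]] := frac_common u v; elim/frac_ind: z => m z.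
exists (m + n)%N, (t ^+ m * x), (t ^+ m * y), (t ^+ n * z).
by rewrite -!(frac_shift m) addnC -frac_shift.
Qed.

Definition loc_add (u v : loc) : loc :=
  let: (n, x) := repr u in let: (m, y) := repr v in
  frac (n + m) (t ^+ m * x + t ^+ n * y).
Definition loc_opp (u : loc) : loc := let: (n, x) := repr u in frac n (- x).
Definition loc_mul (u v : loc) : loc :=
  let: (n, x) := repr u in let: (m, y) := repr v in
  frac (n + m) (iter m S x * y).

Lemma repr_frac n x : t ^+ (repr (frac n x)).1 * x = t ^+ n * (repr (frac n x)).2.
Proof. by apply/fracP; rewrite /frac -surjective_pairing reprK. Qed.

Lemma fracD n x y : loc_add (frac n x) (frac n y) = frac n (x + y).
Proof.
rewrite /loc_add; move: (repr_frac n x) (repr_frac n y).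
case: (repr _) => n' x' /= xx'; case: (repr _) => m' y' /= yy'.
apply/fracP; rewrite mulrDr tw_exprC -xx' [t ^+ n * _ in X in _ + X]tw_exprC -yy'.
by rewrite tw_exprC -mulrDr -mulrDr mulrA -exprD.
Qed.

Lemma fracN n x : loc_opp (frac n x) = frac n (- x).
Proof.
rewrite /loc_opp; move: (repr_frac n x); case: (repr _) => n' x' /= xx'.
by apply/fracP; rewrite !mulrN xx'.
Qed.

Lemma fracM n x m y :
  loc_mul (frac n x) (frac m y) = frac (n + m) (iter m S x * y).
Proof.
rewrite /loc_mul; move: (repr_frac n x) (repr_frac m y).
case: (repr _) => n' x' /= xx'; case: (repr _) => m' y' /= yy'.
apply/fracP.
have -> : t ^+ (n' + m') * (iter m S x * y) =
          t ^+ n' * (t ^+ m * (iter m' S x * y')).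
  rewrite exprD -mulrA; congr (_ * _).
  by rewrite !mulrA !tw_expr_comm -!iterD [(m' + m)%N]addnC -!mulrA yy'.
have -> : t ^+ n' * (t ^+ m * (iter m' S x * y')) =
          t ^+ m * (t ^+ n * (iter m' S x' * y')).
  rewrite tw_exprC; congr (_ * _); rewrite !mulrA; congr (_ * _).
  by rewrite -{1}(tw_iterX m' n') -tw_iterM xx' tw_iterM tw_iterX.
by rewrite tw_exprC exprD -mulrA.
Qed.

Fact loc_addC : commutative loc_add.
Proof.
by move=> u v; have [n [x [y [-> ->]]]] := frac_common u v; rewrite !fracD addrC.
Qed.

Fact loc_addA : associative loc_add.
Proof.
move=> u v z; have [n [x [y [z' [-> -> ->]]]]] := frac_common3 u v z.
by rewrite !fracD addrA.
Qed.

Lemma frac0 n : frac n 0 = frac 0 0.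
Proof. by apply/fracP; rewrite !mulr0. Qed.

Fact loc_add0 : left_id (frac 0 0) loc_add.
Proof. by elim/frac_ind => n x; rewrite -(frac0 n) fracD add0r. Qed.

Fact loc_addN : left_inverse (frac 0 0) loc_opp loc_add.
Proof. by elim/frac_ind => n x; rewrite fracN fracD addNr frac0. Qed.

HB.instance Definition _ := GRing.isZmodule.Build loc
  loc_addA loc_addC loc_add0 loc_addN.

Fact loc_mulA : associative loc_mul.
Proof.
elim/frac_ind=> n x; elim/frac_ind=> m y; elim/frac_ind=> k z.
by rewrite !fracM tw_iterM -iterD addnA mulrA [(k + m)%N]addnC.
Qed.

Fact loc_mul1l : left_id (frac 0 1) loc_mul.
Proof.
elim/frac_ind=> n x; rewrite fracM; congr frac.
by rewrite -(expr0 t) tw_iterX mul1r.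
Qed.

Fact loc_mul1r : right_id (frac 0 1) loc_mul.
Proof. by elim/frac_ind=> n x; rewrite fracM addn0 mulr1. Qed.

Fact loc_mulDl : left_distributive loc_mul +%R.
Proof.
move=> u v; elim/frac_ind=> m z; have [n [x [y [-> ->]]]] := frac_common u v.
by rewrite [_ + _]fracD !fracM [RHS]fracD tw_iterD mulrDl.
Qed.

Fact loc_mulDr : right_distributive loc_mul +%R.
Proof.
move=> z u v; elim/frac_ind: z=> m z; have [n [x [y [-> ->]]]] := frac_common u v.
by rewrite [_ + _]fracD !fracM [RHS]fracD mulrDr.
Qed.

Fact loc_1neq0 : frac 0 1 != 0.
Proof. by apply/eqP => /fracP/eqP; rewrite !mul1r oner_eq0. Qed.

HB.instance Definition _ := GRing.Zmodule_isNzRing.Build loc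
  loc_mulA loc_mul1l loc_mul1r loc_mulDl loc_mulDr loc_1neq0.

Definition loc_inverse (u v : loc) : Prop := v * u = 1 /\ u * v = 1.
Definition loc_unit : {pred loc} := fun u => `[< exists v, loc_inverse u v >].
Definition loc_inv (u : loc) : loc :=
  if pselect (exists v, loc_inverse u v) is left ex then projT1 (cid ex) else u.

Fact loc_mulVr : {in loc_unit, left_inverse 1 loc_inv *%R}.
Proof.
move=> u /asboolP exv; rewrite /loc_inv; case: pselect => // {}exv.
by case: (cid exv) => v [].
Qed.

Fact loc_mulrV : {in loc_unit, right_inverse 1 loc_inv *%R}.
Proof.
move=> u /asboolP exv; rewrite /loc_inv; case: pselect => // {}exv.
by case: (cid exv) => v [].
Qed.

Fact loc_unitP u v : v * u = 1 /\ u * v = 1 -> loc_unit u.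
Proof. by move=> uv; apply/asboolP; exists v. Qed.

Fact loc_inv_out : {in [predC loc_unit], loc_inv =1 id}.
Proof.
move=> u /asboolP exv; rewrite /loc_inv; case: pselect => // {}exv.
Qed.

HB.instance Definition _ := GRing.NzRing_hasMulInverse.Build loc
  loc_mulVr loc_mulrV loc_unitP loc_inv_out.

Definition to_loc (x : O) : loc := frac 0 x.

Fact to_loc_zmod : zmod_morphism to_loc.
Proof. by move=> x y; rewrite /to_loc [- frac _ _]fracN [RHS]fracD. Qed.

Fact to_loc_monoid : monoid_morphism to_loc.
Proof. by split=> // x y; rewrite [RHS]fracM. Qed.

HB.instance Definition _ := GRing.isZmodMorphism.Build O loc to_loc to_loc_zmod.
HB.instance Definition _ := GRing.isMonoidMorphism.Build O loc to_loc to_loc_monoid.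

Lemma to_loc_inj : injective to_loc.
Proof. by move=> x y /fracP; rewrite !mul1r. Qed.

Lemma frac_var n : frac n (t ^+ n) = 1.
Proof. by apply/fracP; rewrite !mul1r mulr1. Qed.

Lemma fracE n x : frac n x = frac n 1 * to_loc x.
Proof. by rewrite [RHS]fracM addn0 mul1r. Qed.

Lemma frac_mul_var n : frac n 1 * to_loc (t ^+ n) = 1.
Proof. by rewrite -fracE frac_var. Qed.

Lemma var_mul_frac n : to_loc (t ^+ n) * frac n 1 = 1.
Proof. by rewrite [LHS]fracM add0n tw_iterX mulr1 frac_var. Qed.

(** For x = u t^m with u a unit, the inverse of t^-n x is t^-m u^-1 t^n. *)
Lemma loc_skew_field :
  (forall x, x != 0 -> exists u v n, [/\ v * u = 1, u * v = 1 & x = u * t ^+ n]) ->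
  skew_field loc.
Proof.
move=> Ofactor u; elim/frac_ind: u => n x nx0.
have [|y [z [m [zy yz def_x]]]] := Ofactor x.
  by apply: contraNneq nx0 => ->; rewrite frac0.
have zyl : to_loc z * to_loc y = 1 by rewrite -rmorphM zy rmorph1.
have yzl : to_loc y * to_loc z = 1 by rewrite -rmorphM yz rmorph1.
apply/(@loc_unitP _ (frac m 1 * to_loc z * to_loc (t ^+ n))).
rewrite (fracE n x) def_x rmorphM; split.
  rewrite -[LHS]mulrA (mulrA (to_loc (t ^+ n))) var_mul_frac mul1r.
  by rewrite -mulrA (mulrA (to_loc z)) zyl mul1r frac_mul_var.
rewrite !mulrA -(mulrA (frac n 1 * _)) var_mul_frac mulr1.
by rewrite -(mulrA (frac n 1)) yzl mulr1 frac_mul_var.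
Qed.

End Localization.

(** * Places between skew fields *)

(** A place as a partial map, encoded by its graph.  The clause [placeV]
    says that the domain is a local ring whose maximal ideal is the kernel;
    [place0_eq] gives single-valuedness, by subtraction.  The relational form
    makes the composition of places immediate. *)
Record place (Y Z : unitRingType) (r : Y -> Z -> Prop) : Prop := Place {
  place1 : r 1 1;
  placeB : forall x y u v, r x u -> r y v -> r (x - y) (u - v);
  placeM : forall x y u v, r x u -> r y v -> r (x * y) (u * v);
  placeV : forall x u, r x u -> u != 0 -> r x^-1 u^-1;
  place0_eq : forall u, r 0 u -> u = 0
}.

Section PlaceTheory.
Variables (Y Z : unitRingType) (r : Y -> Z -> Prop).
Hypothesis rP : place r.

Lemma place0 : r 0 0.
Proof. by rewrite -(subrr 1) -[X in r _ X](subrr 1); apply: (placeB rP); apply: (place1 rP). Qed.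

Lemma placeN x u : r x u -> r (- x) (- u).
Proof. by move=> xu; rewrite -(sub0r x) -(sub0r u); apply: (placeB rP) => //; apply: place0. Qed.

Lemma placeD x y u v : r x u -> r y v -> r (x + y) (u + v).
Proof.
by move=> xu yv; rewrite -(opprK y) -(opprK v); apply: (placeB rP) => //; apply: placeN.
Qed.

Lemma place_neq0 x u : r x u -> u != 0 -> x != 0.
Proof. by move=> xu; apply: contraNneq => x0; apply/eqP/(place0_eq rP); rewrite -x0. Qed.

Lemma place_fun x u v : r x u -> r x v -> u = v.
Proof.
move=> xu xv; apply/eqP; rewrite -subr_eq0; apply/eqP/(place0_eq rP).
by rewrite -(subrr x); apply: (placeB rP).
Qed.

End PlaceTheory.

Lemma place_comp (X Y Z : unitRingType) (r : X -> Y -> Prop) (s : Y -> Z -> Prop) :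
  place r -> place s -> place (fun x z => exists2 y, r x y & s y z).
Proof.
move=> rP sP; split.
- by exists 1; [apply: (place1 rP) | apply: (place1 sP)].
- by move=> x x' z z' [y ? ?] [y' ? ?]; exists (y - y'); [apply: (placeB rP) | apply: (placeB sP)].
- by move=> x x' z z' [y ? ?] [y' ? ?]; exists (y * y'); [apply: (placeM rP) | apply: (placeM sP)].
- move=> x z [y xy yz] z0; exists y^-1; last exact: (placeV sP).
  by apply: (placeV rP) => //; apply: (place_neq0 sP yz).
- by move=> z [y /(place0_eq rP) -> /(place0_eq sP)].
Qed.

(** A map of the free algebra to a skew field Y need not be epic, and the
    universal property only speaks of epic maps; it is applied to the subfield
    generated by the image. *)
Section GeneratedSubfield.
Variables (Y : unitRingType) (S : Y -> Prop).

Definition gen_pred : {pred Y} := fun y => `[< in_skew_subfield S y >].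

Lemma gen_predP y : reflect (in_skew_subfield S y) (y \in gen_pred).
Proof. exact: asboolP. Qed.

Fact gen_pred_closed : divring_closed gen_pred.
Proof.
split.
- by apply/gen_predP => P [].
- move=> x y /gen_predP Sx /gen_predP Sy; apply/gen_predP => P Pdiv SP.
  by case: (Pdiv) => _ PB _; apply: PB; [apply: Sx | apply: Sy].
- move=> x y /gen_predP Sx /gen_predP Sy; apply/gen_predP => P Pdiv SP.
  by case: (Pdiv) => _ _ PV; apply: PV; [apply: Sx | apply: Sy].
Qed.

Record gen_field := GenField { gen_val : Y; _ : gen_val \in gen_pred }.
HB.instance Definition _ := [isSub for gen_val].
HB.instance Definition _ := [Choice of gen_field by <:].
HB.instance Definition _ :=
  GRing.SubChoice_isSubUnitRing.Build Y gen_pred gen_field gen_pred_closed.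

Lemma gen_field_skew : skew_field Y -> skew_field gen_field.
Proof.
move=> Yfield x x0; have vx0 : val x != 0.
  by apply: contraNneq x0 => vx0; apply/eqP/val_inj; rewrite vx0 rmorph0.
have Vx : (val x)^-1 \in gen_pred.
  by case: gen_pred_closed => P1 _ PV; rewrite -[_^-1]mul1r PV ?(valP x).
apply/unitrP; exists (Sub (val x)^-1 Vx).
by split; apply: val_inj; rewrite rmorphM rmorph1 /= ?mulVr ?mulrV ?Yfield.
Qed.

End GeneratedSubfield.

(** * Morphisms out of a universal field of fractions *)

Section Universality.
Variables (R : nzRingType) (D : unitRingType) (f : {rmorphism R -> D}).
Hypothesis univ : universal_Rfield f.

Let Dfield : skew_field D. Proof. by case: univ => -[]. Qed.

Lemma universal_ind (P : D -> Prop) :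
  (forall r, P (f r)) -> (forall x y, P x -> P y -> P (x - y)) ->
  (forall x y, P x -> P y -> P (x * y)) ->
  (forall x, x != 0 -> P x -> P x^-1) -> forall x, P x.
Proof.
move=> Pf PB PM PV x.
have [[_ gen_f] _] := univ.
have /asboolP // : x \in (fun y => `[< P y >] : bool).
apply: gen_f => [|y [r ->]]; last exact/asboolP.
split=> [|y z /asboolP Py /asboolP Pz|y z /asboolP Py /asboolP Pz]; apply/asboolP.
- by rewrite -(rmorph1 f).
- exact: PB.
apply: PM => //; have [->|z0] := eqVneq z 0; last exact: PV.
by rewrite invr0 -(rmorph0 f).
Qed.

Lemma specialize (Y : unitRingType) (g : {rmorphism R -> Y}) :
  skew_field Y -> exists s, place s /\ forall r, s (f r) (g r).
Proof.
move=> Yfield; pose S y := exists r, y = g r.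
have gS r : g r \in gen_pred S by apply/gen_predP => P _; apply; exists r.
pose h r : gen_field S := Sub (g r) (gS r).
have hB : zmod_morphism h by move=> x y; apply: val_inj; rewrite /= !rmorphB.
have hM : monoid_morphism h.
  by split=> [|x y]; apply: val_inj; rewrite /= ?rmorphM ?rmorph1.
pose hB' := GRing.isZmodMorphism.Build _ _ h hB.
pose hM' := GRing.isMonoidMorphism.Build _ _ h hM.
pose H : {rmorphism R -> gen_field S} := HB.pack h hB' hM'.
have Hepic : epic_Rfield H.
  split=> [|x P Pdiv HP]; first exact: gen_field_skew.
  have [P1 PB PV] := Pdiv.
  pose Q : {pred Y} := fun y => `[< exists2 z, z \in P & y = val z >].
  have /gen_predP/(_ Q) := valP x; case/(_ _ _)/asboolP => [||z Pz].
  - split; first by apply/asboolP; exists 1 => //; rewrite rmorph1.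
      move=> _ _ /asboolP[y Py ->] /asboolP[z Pz ->]; apply/asboolP.
      by exists (y - z); rewrite ?PB ?rmorphB.
    move=> _ _ /asboolP[y Py ->] /asboolP[z Pz ->]; apply/asboolP.
    exists (y / z); first exact: PV.
    have [->|z0] := eqVneq z 0; first by rewrite !(invr0, mulr0, rmorph0).
    by rewrite rmorphM rmorphV //; apply: gen_field_skew z0.
  - move=> _ [r ->]; apply/asboolP; exists (H r) => //.
    by apply: HP; exists r.
  by move/val_inj ->.
have [_ /(_ _ H Hepic)[U0 [phi [U0ring fU phiB phiM phiV]]]] := univ.
have [U1 UB UM] := U0ring.
exists (fun x y => x \in U0 /\ val (phi x) = y); split; last first.
  by move=> r; have [? ->] := fU r.
have phi1 : phi 1 = 1 by have [_] := fU 1; rewrite !rmorph1.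
have phi0 : phi 0 = 0 by have [_] := fU 0; rewrite !rmorph0.
split.
- by rewrite phi1 rmorph1.
- by move=> x y _ _ [Ux <-] [Uy <-]; rewrite UB // phiB // rmorphB.
- by move=> x y _ _ [Ux <-] [Uy <-]; rewrite UM // phiM // rmorphM.
- move=> x _ [Ux <-] vx0.
  have px0 : phi x != 0 by apply: contraNneq vx0 => ->; rewrite rmorph0.
  have x0 : x != 0 by apply: contraNneq px0 => ->; rewrite phi0.
  have UVx := phiV x Ux px0; split=> //.
  have E : val (phi x^-1) * val (phi x) = 1.
    by rewrite -rmorphM -phiM // mulVr ?Dfield // phi1 rmorph1.
  by apply: (mulIr (Yfield _ vx0)); rewrite E mulVr ?Yfield.
by move=> _ [_ <-]; rewrite phi0 rmorph0.
Qed.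

(** Genericity criterion.  Let s be the place from D to Y that extends g.  The
    elements z such that s is defined at z and r sends the value to H z form a
    skew subfield: if z <> 0 then H z <> 0, so the value of s at z is nonzero
    and both places can be inverted there.  As it contains the image of R, this
    subfield is D, and s is defined everywhere. *)
Lemma extend (Y Z : unitRingType) (g : {rmorphism R -> Y})
    (H : {rmorphism D -> Z}) (r : Y -> Z -> Prop) :
  skew_field Y -> place r -> (forall x, r (g x) (H (f x))) ->
  exists G : {rmorphism D -> Y}, (forall x, G (f x) = g x) /\ (forall z, r (G z) (H z)).
Proof.
move=> Yfield rP rgH; have [s [sP sfg]] := specialize g Yfield.
have exG z : exists y, s z y /\ r y (H z).
  elim/universal_ind: z => [x|x y [u [? ?]] [v [? ?]]|x y [u [? ?]] [v [? ?]]|x x0 [u [xu ux]]].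
  - by exists (g x).
  - by exists (u - v); rewrite rmorphB; split; [apply: (placeB sP) | apply: (placeB rP)].
  - by exists (u * v); rewrite rmorphM; split; [apply: (placeM sP) | apply: (placeM rP)].
  have Hx0 : H x != 0.
    apply/eqP => Hx0; have /eqP := congr1 H (mulrV (Dfield x0)).
    by rewrite rmorphM rmorph1 Hx0 mul0r eq_sym oner_eq0.
  exists u^-1; rewrite rmorphV ?Dfield //.
  by split; [apply: (placeV sP) | apply: (placeV rP)] => //; apply: (place_neq0 rP ux).
pose G z := projT1 (cid (exG z)).
have sG z : s z (G z) /\ r (G z) (H z) by rewrite /G; case: cid.
have GB : zmod_morphism G.
  move=> x y; apply: (place_fun sP (sG _).1).
  by apply: (placeB sP); apply: (sG _).1.
have GM : monoid_morphism G.
  split=> [|x y]; apply: (place_fun sP (sG _).1); first exact: (place1 sP).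
  by apply: (placeM sP); apply: (sG _).1.
pose GB' := GRing.isZmodMorphism.Build _ _ G GB.
pose GM' := GRing.isMonoidMorphism.Build _ _ G GM.
pose G' : {rmorphism D -> Y} := HB.pack G GB' GM'.
exists G'; split=> z /=; last exact: (sG z).2.
exact: (place_fun sP (sG _).1).
Qed.

End Universality.

(** * The field of skew Laurent series *)

Section Laurent.
Variables (D : unitRingType) (sigma : {rmorphism D -> D}).
Hypothesis Dfield : skew_field D.

Fact ser_map_var : ser_map (serX sigma) = serX sigma.
Proof. by apply: funext => n; apply: rmorph_nat. Qed.

Definition series_twist : twist (series sigma) :=
  Twist (tw_map := ser_map (sigma := sigma)) (@serXM _ sigma) ser_map_var
    (serX_reg Dfield).

Definition laurent : unitRingType := loc series_twist.
Definition to_laurent : {rmorphism series sigma -> laurent} :=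
  to_loc series_twist.

Lemma laurent_skew_field : skew_field laurent.
Proof.
apply: loc_skew_field => x /(series_factor)[u [n [u0 def_x]]].
by have [v [vu uv]] := series_inv Dfield u0; exists u, v, n.
Qed.

Definition residue (u : laurent) (a : D) : Prop :=
  exists2 x : series sigma, u = to_laurent x & x 0%N = a.

Lemma residue_series x : residue (to_laurent x) (x 0%N).
Proof. by exists x. Qed.

Lemma to_laurent_inj : injective to_laurent.
Proof. exact: to_loc_inj. Qed.

Lemma place_residue : place residue.
Proof.
split.
- by exists 1; rewrite ?rmorph1.
- by move=> _ _ a b [x -> <-] [y -> <-]; exists (x - y); rewrite ?rmorphB.
- move=> _ _ a b [x -> <-] [y -> <-]; exists (x * y); rewrite ?rmorphM //.
  exact: ser_coefM0.
- move=> _ a [x -> <-] x0; have [y [yx xy]] := series_inv Dfield x0.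
  have yx1 : to_laurent y * to_laurent x = 1 by rewrite -rmorphM yx rmorph1.
  have xy1 : to_laurent x * to_laurent y = 1 by rewrite -rmorphM xy rmorph1.
  have Ux : to_laurent x \is a GRing.unit by apply/unitrP; exists (to_laurent y).
  exists y; first by apply: (mulrI Ux); rewrite mulrV.
  apply: (mulrI (Dfield x0)); rewrite mulrV ?Dfield //.
  by rewrite -[LHS](@ser_coefM0 _ sigma) xy.
move=> a [x x0 <-]; rewrite (_ : x = 0) //.
by apply: to_laurent_inj; rewrite -x0 rmorph0.
Qed.

End Laurent.

(** * Evaluation of noncommutative polynomials *)

Section FreeAlgebra.
Variables (K : fieldType) (n : nat).
Local Notation R := (freeAlg K n).

Lemma freeAlg_ind (P : R -> Prop) :
  (forall c, P (freeConst n c)) -> (forall i, P (freeVar K i)) ->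
  (forall x y, P x -> P y -> P (x + y)) ->
  (forall x y, P x -> P y -> P (x * y)) -> forall x, P x.
Proof.
move=> Pc Pv PD PM x; rewrite (monalgE x).
apply: (big_ind P) => // [|m _].
  by have := Pc 0; rewrite /freeConst rmorph0.
have -> : << x@_m *g m >> = freeConst n x@_m * << m >> :> R.
  rewrite /freeConst mul_malgC; apply/malgP => k.
  by rewrite mcoeffZ !mcoeffU mulr_natr.
apply: (PM _ _ (Pc _)); elim: {x m}(size m) {-2}m (erefl (size m)) => [|l IHl] m.
  move/eqP/nilP => m1; have := Pc 1; rewrite /freeConst.
  by congr (P << _ *g _ >>); apply/eqP; rewrite fmP fm1 m1.
case def_m: (fmonom_val m) => [|i s] // [sl].
have -> : << m >> = freeVar K i * << fmonom_of_seq fmonom_key s >> :> R.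
  rewrite malgM_def fgmulUU mulr1; congr << _ *g _ >>.
  by apply/eqP; rewrite fmP fmM fmU fmE def_m.
by apply: (PM _ _ (Pv i)); apply: IHl; rewrite fmE.
Qed.

Section Eval.
Variables (S : nzRingType) (kappa : {rmorphism K -> S}) (y : 'I_n -> S).
Hypothesis comm_y : forall c i, GRing.comm (kappa c) (y i).

Definition word_eval (m : {fmonom 'I_n}) : S := \prod_(i <- m) y i.

Fact word_eval_mmorphism : mmorphism word_eval.
Proof.
split=> [m1 m2|]; rewrite /word_eval.
  by rewrite fmM big_cat.
by rewrite fm1 big_nil.
Qed.

HB.instance Definition _ := monalg.isMultiplicative.Build _ _ word_eval
  word_eval_mmorphism.

Lemma freeAlg_eval : exists g : {rmorphism R -> S},
  (forall c, g (freeConst n c) = kappa c) /\ (forall i, g (freeVar K i) = y i).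
Proof.
have comm_w (g : R) m m' : GRing.comm (kappa g@_m) (word_eval m').
  by apply: commr_prod.
have [gM g1] := commr_mmap_is_multiplicative comm_w.
pose g : R -> S := mmap kappa word_eval.
pose gB' := GRing.isZmodMorphism.Build _ _ g (@mmap_is_additive _ _ _ kappa word_eval).
pose gM' := GRing.isMonoidMorphism.Build _ _ g (g1, gM).
pose G : {rmorphism R -> S} := HB.pack g gB' gM'.
exists G; split=> [c|i]; first exact: mmapC.
transitivity (kappa 1 * word_eval (fmu i)); first exact: mmapU.
by rewrite rmorph1 mul1r /word_eval fmU big_seq1.
Qed.
End Eval.
End FreeAlgebra.

(** * Conjugation by differences *)

(** These instances make the tactic [non_commutative_ring] decide the polynomial
    identities below. *)
#[local] Instance nc_ring_ops (D : pzRingType) :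
  @Ncring.Ring_ops D 0 1 +%R *%R (fun x y => x - y) -%R eq := {}.
#[local] Instance nc_ring (D : pzRingType) :
  @Ncring.Ring _ _ _ _ _ _ _ _ (nc_ring_ops D).
Proof.
split; try exact _.
- exact: add0r.
- exact: addrC.
- exact: addrA.
- exact: mul1r.
- exact: mulr1.
- exact: mulrA.
- exact: mulrDl.
- by move=> x y z; apply: mulrDr.
- by [].
- exact: subrr.
Qed.

Section Conjugation.
Variable D : unitRingType.
Hypothesis Dfield : skew_field D.
Implicit Types x y : D.

Lemma C_id x : C x x = 0.
Proof. by rewrite /C subrr !mul0r. Qed.

Lemma C_mul y x : y != x -> C y x * (y - x) = (y - x) * x.
Proof. by move=> yx; rewrite /C mulrVK // Dfield // subr_eq0. Qed.

Lemma skew_mulIf z x y : z != 0 -> x * z = y * z -> x = y.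
Proof. by move/Dfield/mulIr; apply. Qed.

Lemma skew_mul_eq0 x y : y != 0 -> x * y = 0 -> x = 0.
Proof. by move=> y0 xy0; apply: (skew_mulIf y0); rewrite mul0r. Qed.

(** The polynomial (t - C y x) (t - y) = (t - C x y) (t - x) is the least common
    left multiple of t - x and t - y; this compares the coefficients of t. *)
Lemma C_sum y x : y != x -> C y x = C x y + x - y.
Proof.
move=> yx; have xy : x != y by rewrite eq_sym.
have yx0 : y - x != 0 by rewrite subr_eq0.
apply: (skew_mulIf yx0); rewrite C_mul //.
have -> : (C x y + x - y) * (y - x) = (x - y) * (y - x) - C x y * (x - y).
  non_commutative_ring.
by rewrite C_mul //; non_commutative_ring.
Qed.

End Conjugation.

(** * Twisted derivations and the four pseudo-roots *)

Section TwistedDerivation.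
Variables (D : unitRingType) (sigma : {rmorphism D -> D}) (delta : D -> D).
Hypothesis Dfield : skew_field D.
Hypothesis deltaB : forall x y, delta (x - y) = delta x - delta y.
Hypothesis deltaM : forall x y, delta (x * y) = delta x * sigma y + x * delta y.

Lemma delta0 : delta 0 = 0.
Proof. by have := deltaB 0 0; rewrite !subrr. Qed.

Lemma delta1 : delta 1 = 0.
Proof.
have := deltaM 1 1; rewrite rmorph1 !mulr1 mul1r => /eqP.
by rewrite -[X in X == _]addr0 (inj_eq (addrI _)) eq_sym => /eqP.
Qed.

Lemma delta_cancel x u : u != 0 -> delta x * sigma u = 0 -> delta x = 0.
Proof.
move=> u0; apply: skew_mul_eq0 => //.
by rewrite -(rmorph0 sigma) (inj_eq (rmorph_skew_inj Dfield)).
Qed.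

Lemma deltaV_eq0 x : delta x = 0 -> delta x^-1 = 0.
Proof.
have [-> _|x0 dx] := eqVneq x 0; first by rewrite invr0 delta0.
apply: (delta_cancel x0); apply/eqP; rewrite -subr_eq0; apply/eqP.
by have := deltaM x^-1 x; rewrite mulVr ?Dfield // delta1 dx mulr0 addr0 subr0.
Qed.

(** Differentiate C y x * (y - x) = (y - x) * x, which avoids inverses. *)
Lemma deltaC_mul y x : y != x ->
  delta (C y x) * sigma (y - x) =
  (y - x) * delta x + (delta y - delta x) * sigma x - C y x * (delta y - delta x).
Proof.
move=> yx; have := congr1 delta (C_mul Dfield yx).
rewrite [LHS]deltaM [RHS]deltaM -!deltaB => /(canRL (addrK _)) ->.
by rewrite [_ + _ * delta x]addrC.
Qed.

Lemma deltaC_eq0 y x : delta y = 0 -> delta x = 0 -> delta (C y x) = 0.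
Proof.
move=> dy dx; have [->|yx] := eqVneq y x; first by rewrite C_id delta0.
have yx0 : y - x != 0 by rewrite subr_eq0.
by apply: (delta_cancel yx0); rewrite deltaC_mul // dy dx subrr !mulr0 mul0r addr0 subr0.
Qed.

Lemma kernel_divring_closed : divring_closed [pred x | delta x == 0].
Proof.
split=> [|x y /eqP dx /eqP dy|x y /eqP dx /eqP dy]; rewrite inE.
- by rewrite delta1.
- by rewrite deltaB dx dy subrr.
- by rewrite deltaM dx deltaV_eq0 // mul0r mulr0 addr0.
Qed.

(** The tangent vector in the fibre of (a, b, c, d) |-> (p, q, r, s).  Here n is
    the value at c of the least common left multiple of t - b and t - d, and the
    last factor in the formula for sigma b is its value at a. *)
Section Fibre.
Variables a b c d : D.
Let g := c - a.
Let f := c - d.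
Let n := f * c - C d b * f.
Hypothesis ca : c != a.
Hypothesis db : d != b.
Hypothesis cd : c != d.
Hypothesis ng0 : n + g * g != 0.
Hypotheses (delta_a : delta a = 0) (delta_b : delta b = 0).
Hypotheses (delta_c : delta c = g) (delta_d : delta d = g + f).
Hypotheses (sigma_c : sigma c = a) (sigma_d : sigma d = c + g).
Hypothesis sigma_b : sigma b =
  a + g * (n + g * g)^-1 * ((a - d) * a - C d b * (a - d)).

Lemma delta_p_eq0 : delta (C b a) = 0.
Proof. exact: deltaC_eq0. Qed.

Lemma delta_q_eq0 : delta (C (C a c) (C a b)) = 0.
Proof.
apply: deltaC_eq0; last exact: deltaC_eq0.
(* C a c does not move: (a - c) g - g a + g c = 0 because g = c - a. *)
have ac : a != c by rewrite eq_sym.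
have ac0 : a - c != 0 by rewrite subr_eq0.
apply: (delta_cancel ac0); rewrite deltaC_mul // delta_a delta_c sigma_c.
have -> : (a - c) * g + (0 - g) * a - C a c * (0 - g) =
   (a - c) * g - g * a - C a c * (a - c).
  by rewrite /g; non_commutative_ring.
by rewrite C_mul // /g; non_commutative_ring.
Qed.

Lemma delta_f : delta f = - f.
Proof. by rewrite deltaB delta_c delta_d opprD addNKr. Qed.

Lemma delta_s_eq0 : delta (C c d) = 0.
Proof.
have cd0 : c - d != 0 by rewrite subr_eq0.
apply: (delta_cancel cd0); rewrite deltaC_mul // delta_c delta_d sigma_d.
have -> : g - (g + f) = - (c - d) by rewrite /g /f; non_commutative_ring.
rewrite mulrN C_mul // /g /f; non_commutative_ring.
Qed.

(** Solving delta n = n for delta (C d b) gives this formula; the value of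
    sigma b is the one for which it agrees with the derivative of C d b. *)
Lemma delta_bd : delta (C d b) * g = f * a - C d b * f.
Proof.
have g0 : g != 0 by rewrite subr_eq0.
have db0 : d - b != 0 by rewrite subr_eq0.
suff -> : delta (C d b) = (f * a - C d b * f) * g^-1 by rewrite mulrVK // Dfield.
have sdb0 : sigma (d - b) != 0.
  by rewrite -(rmorph0 sigma) (inj_eq (rmorph_skew_inj Dfield)).
apply: (skew_mulIf Dfield sdb0); rewrite deltaC_mul // delta_b delta_d rmorphB sigma_d.
set Z := _ * g^-1; set u := C d b.
have Zg : Z * g = f * a - u * f by rewrite mulrVK // Dfield.
have Z_b : (Z + (g + f)) * g = n + g * g.
  by rewrite mulrDl Zg /n -/u /g; non_commutative_ring.
have key : (Z + (g + f)) * (sigma b - a) = (a - d) * a - u * (a - d).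
  rewrite sigma_b (addrC a) addrK.
  by rewrite !mulrA Z_b mulrV ?Dfield // mul1r.
have -> : Z * (c + g - sigma b) = Z * (c + g - a) + (g + f) * (sigma b - a) -
    (Z + (g + f)) * (sigma b - a) by non_commutative_ring.
rewrite key.
have -> : Z * (c + g - a) = (Z * g) + (Z * g) by rewrite /g; non_commutative_ring.
by rewrite Zg /g /f; non_commutative_ring.
Qed.

Lemma delta_n : delta n = n.
Proof.
have -> : delta n = f * g - f * a - delta (C d b) * sigma f - C d b * - f.
  rewrite /n deltaB !deltaM delta_f delta_c sigma_c.
  by non_commutative_ring.
have -> : sigma f = - (g + g).
  by rewrite rmorphB sigma_c sigma_d /g; non_commutative_ring.
have -> : f * g - f * a - delta (C d b) * - (g + g) - C d b * - f =
  f * g - f * a + delta (C d b) * g + delta (C d b) * g + C d b * f.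
  by non_commutative_ring.
by rewrite delta_bd /n /g; non_commutative_ring.
Qed.

(** The element n conjugates c into r.  Applying delta to r n = n c, the right
    side gives n a + n (c - a) = n c = r n, which is r delta n; so what remains
    is delta r * sigma n = 0. *)
Lemma delta_r_eq0 : delta (C (C b d) (C b c)) = 0.
Proof.
(* In the two degenerate cases the inverse in the definition of C is that of 0,
   and r = 0. *)
have [->|bc] := eqVneq (C b d) (C b c); first by rewrite C_id delta0.
have [->|cb] := eqVneq c b; first by rewrite C_id /C !(mulr0, mul0r) delta0.
have bc' : b != c by rewrite eq_sym.
have cb0 : c - b != 0 by rewrite subr_eq0.
have Cbc : C b c * (c - b) = (c - b) * c.
  by rewrite -[c - b]opprB mulrN C_mul // mulNr.
have def_n : n = - ((C b d - C b c) * (c - b)).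
  have -> : - ((C b d - C b c) * (c - b)) = C b c * (c - b) - C b d * (c - b).
    by non_commutative_ring.
  rewrite Cbc (C_sum Dfield) 1?eq_sym // /n /f.
  have -> : (C d b + d - b) * (c - b) =
      C d b * (c - d) + C d b * (d - b) + (d - b) * (c - b).
    by non_commutative_ring.
  by rewrite C_mul //; non_commutative_ring.
have rn : C (C b d) (C b c) * n = n * c.
  by rewrite def_n mulrN mulrA C_mul // -mulrA Cbc mulrA mulNr.
have n0 : n != 0.
  rewrite def_n oppr_eq0; apply: contraNneq bc => /(skew_mul_eq0 Dfield cb0).
  by move/eqP; rewrite subr_eq0.
apply: (delta_cancel n0); have := congr1 delta rn.
rewrite !deltaM delta_n delta_c sigma_c rn -mulrDr /g.
have -> : a + (c - a) = c by rewrite addrC subrK.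
by move/eqP; rewrite -subr_eq0 addrK => /eqP.
Qed.

End Fibre.
End TwistedDerivation.

(** * Endomorphisms and derivations of the free skew field *)

Section FreeSkewField.
Variables (K : fieldType) (N : nat) (D : unitRingType).
Variable f : {rmorphism freeAlg K N -> D}.
Hypothesis freeD : free_skew_field f.
Local Notation R := (freeAlg K N).

Let univ : universal_Rfield f. Proof. by case: freeD. Qed.

Lemma free_skew_field_skew : skew_field D. Proof. by case: univ => -[]. Qed.
Let Dfield := free_skew_field_skew.

Definition scal : {rmorphism K -> D} := f \o (@malgC {fmonom 'I_N} K).
Definition gen (i : 'I_N) : D := f (freeVar K i).

Lemma scal_const c : f (freeConst N c) = scal c. Proof. by []. Qed.

Lemma scal_central c x : scal c * x = x * scal c.
Proof.
elim/(universal_ind univ): x => [r|x y|x y|x x0] //.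
- rewrite -scal_const -!rmorphM; congr (f _).
  elim/freeAlg_ind: r => [c'|i|x y cx cy|x y cx cy].
  + by rewrite /freeConst -!rmorphM mulrC.
  + by rewrite !malgM_def !fgmulUU mulr1 mul1r mulm1 mul1m.
  + by rewrite mulrDl mulrDr cx cy.
  + by rewrite mulrA cx -!mulrA cy.
- by rewrite mulrBl mulrBr => -> ->.
- by move=> cx cy; rewrite mulrA cx -mulrA cy mulrA.
move=> cx; have Ux := Dfield x0.
by apply: (mulrI Ux); rewrite mulrA -cx mulrK // mulVKr.
Qed.

Lemma place_on_gens (Y Z : unitRingType) (r : Y -> Z -> Prop)
    (g : {rmorphism R -> Y}) (h : {rmorphism R -> Z}) :
  place r -> (forall c, r (g (freeConst N c)) (h (freeConst N c))) ->
  (forall i, r (g (freeVar K i)) (h (freeVar K i))) -> forall x, r (g x) (h x).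
Proof.
move=> rP rc rv x; elim/freeAlg_ind: x => // x y rx ry.
  by rewrite !rmorphD; apply: (placeD rP).
by rewrite !rmorphM; apply: (placeM rP).
Qed.

(** A tuple that specializes to the generators satisfies no more rational
    relations than they do. *)
Lemma endo_of_place (r : D -> D -> Prop) (rho : 'I_N -> D) :
  place r -> (forall c, r (scal c) (scal c)) -> (forall i, r (rho i) (gen i)) ->
  exists sigma : {rmorphism D -> D},
    (forall c, sigma (scal c) = scal c) /\ (forall i, sigma (gen i) = rho i).
Proof.
move=> rP rc rrho.
have [g [gc gv]] := @freeAlg_eval K N D scal rho (fun c i => scal_central c (rho i)).
have [|sigma [sigma_f _]] := @extend _ _ _ univ _ _ g idfun r Dfield rP.
  apply: (place_on_gens (h := f) rP) => [c|i]; first by rewrite gc; apply: rc.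
  by rewrite gv; apply: rrho.
exists sigma; split=> [c|i]; first exact: etrans (sigma_f _) (gc c).
exact: etrans (sigma_f _) (gv i).
Qed.

(** The permuted generators are free: the place extending the permutation sends
    them back to the generators. *)
Lemma involution_endo (tau : 'I_N -> 'I_N) : involutive tau ->
  exists sigma : {rmorphism D -> D},
    (forall c, sigma (scal c) = scal c) /\ (forall i, sigma (gen i) = gen (tau i)).
Proof.
move=> tauK.
have [g [gc gv]] := @freeAlg_eval K N D scal (fun i => gen (tau i))
  (fun c i => scal_central c _).
have [s [sP sfg]] := specialize univ g Dfield.
apply: (endo_of_place sP) => [c|i]; first by have := sfg (freeConst N c); rewrite gc.
by have := sfg (freeVar K (tau i)); rewrite gv tauK.
Qed.

(** Evaluation at a point of K^N, which shows that an element is nonzero by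
    computing in K. *)
Lemma scalar_place (v : 'I_N -> K) :
  exists s : D -> K -> Prop,
    [/\ place s, forall c, s (scal c) c & forall i, s (gen i) (v i)].
Proof.
have [g [gc gv]] := @freeAlg_eval K N K idfun v (fun c i => mulrC _ _).
have Kfield : skew_field K by move=> x; rewrite unitfE.
have [s [sP sfg]] := specialize univ g Kfield.
exists s; split=> // [c|i]; first by have := sfg (freeConst N c); rewrite gc.
by have := sfg (freeVar K i); rewrite gv.
Qed.

Lemma gen_inj : injective gen.
Proof.
move=> i j ij; apply/eqP/negbNE/negP => ij'.
have [s [sP _ s_gen]] := scalar_place (fun k => (k == i)%:R).
have si := s_gen i; rewrite ij in si; have := place_fun sP si (s_gen j).
by rewrite eqxx eq_sym (negPf ij') => /eqP; rewrite oner_eq0.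
Qed.

Section Laurent.
Variable sigma : {rmorphism D -> D}.
Hypothesis sigma_scal : forall c, sigma (scal c) = scal c.
Local Notation L := (laurent sigma Dfield).

Lemma laurent_eval (y : 'I_N -> series sigma) :
  exists g : {rmorphism R -> L},
    (forall c, g (freeConst N c) = to_laurent sigma Dfield (serC sigma (scal c))) /\
    (forall i, g (freeVar K i) = to_laurent sigma Dfield (y i)).
Proof.
apply: (@freeAlg_eval K N L (to_laurent sigma Dfield \o (serC sigma \o scal))).
move=> c i; rewrite /GRing.comm /= -!rmorphM; congr (to_laurent _ _ _).
apply: funext => k; rewrite ser_coefCM ser_coefMC scal_central; congr (_ * _).
by elim: k => //= k <-; rewrite sigma_scal.
Qed.

(** In D((t; sigma)) the coefficient of t in a product of two power series x and
    y is x_0 y_1 + x_1 sigma(y_0), so the coefficient of t of an embedding of D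
    that is the identity modulo t is a sigma-derivation. *)
Lemma twisted_derivation (dl : 'I_N -> D) :
  exists delta : D -> D,
    [/\ forall x y, delta (x - y) = delta x - delta y,
        forall x y, delta (x * y) = delta x * sigma y + x * delta y,
        forall c, delta (scal c) = 0 & forall i, delta (gen i) = dl i].
Proof.
pose y i : series sigma := fun n => nth 0 [:: gen i; dl i] n.
have [g [gc gv]] := laurent_eval y.
have Lfield := @laurent_skew_field _ sigma Dfield.
have [|G [G_f G_res]] :=
    extend univ (H := idfun) Lfield (place_residue sigma Dfield) (g := g).
  apply: (place_on_gens (h := f)); first exact: place_residue.
    by move=> c; rewrite gc; apply: residue_series.
  by move=> i; rewrite gv; apply: (residue_series _ (y i)).
have exw z : exists w : series sigma, G z = to_laurent sigma Dfield w /\ w 0%N = z.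
  by have [w Gz w0] := G_res z; exists w.
pose w z := projT1 (cid (exw z)).
have wP z : G z = to_laurent sigma Dfield (w z) by rewrite /w; case: cid => ? [].
have w0 z : w z 0%N = z by rewrite /w; case: cid => ? [].
have w_uniq z v : G z = to_laurent sigma Dfield v -> w z = v.
  by rewrite wP => /to_laurent_inj.
exists (fun z => w z 1%N); split=> [u v|u v|c|i].
- by rewrite (w_uniq (u - v) (w u - w v)) // !rmorphB !wP.
- rewrite (w_uniq (u * v) (w u * w v)); last by rewrite !rmorphM !wP.
  by rewrite ser_coefM1 !w0 addrC.
- by rewrite (w_uniq _ (serC sigma (scal c))) // -gc -G_f.
by rewrite (w_uniq _ (y i)) // -gv -G_f.
Qed.

End Laurent.
End FreeSkewField.

(** * The twist and the derivation on four generators *)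

Section FourGenerators.
Variables (K : fieldType) (D : unitRingType).
Variable f : {rmorphism freeAlg K 4 -> D}.
Hypothesis freeD : free_skew_field f.
Hypothesis two_neq0 : 2%:R != 0 :> K.

Let Dfield : skew_field D := free_skew_field_skew freeD.
Local Notation scal := (scal f).
Local Notation a := (gen f 0).
Local Notation b := (gen f 1).
Local Notation c := (gen f 2).
Local Notation d := (gen f 3).

(** The formula for sigma b at d = 0, where C d b = b, with (a, b, c) replaced by
    (x, y, z): it is linear fractional in y, and y is chosen to give it the
    value w. *)
Lemma solve_root (x y z w : D) (g := z - x) (h := g^-1 * (w - x)) :
  g != 0 -> x - z * h != 0 ->
  y = (x * x - (z * z + g * g) * h) * (x - z * h)^-1 ->
  z * z - y * z + g * g != 0 ->
  x + g * (z * z - y * z + g * g)^-1 * (x * x - y * x) = w.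
Proof.
move=> g0 xz0 def_y ng0.
have yxz : y * (x - z * h) = x * x - (z * z + g * g) * h.
  by rewrite def_y mulrVK // Dfield.
have -> : x * x - y * x = (z * z - y * z + g * g) * h.
  have -> : (z * z - y * z + g * g) * h =
      (z * z + g * g) * h + y * (x - z * h) - y * x by non_commutative_ring.
  by rewrite yxz; non_commutative_ring.
rewrite mulrA mulrVK ?Dfield // mulVKr ?Dfield //.
by rewrite addrC subrK.
Qed.

(* The values of b and c at the degenerate point at which d = 0 and a takes the
   value c, chosen so that the formulas for sigma d and sigma b give d and b. *)
Let half := scal 2%:R^-1.
Let c0 := half * (c + d).
Let g0 := c0 - c.
Let h0 := g0^-1 * (b - c).
Let b0 := (c * c - (c0 * c0 + g0 * g0) * h0) * (c - c0 * h0)^-1.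

Lemma c0_double : c0 + c0 = c + d.
Proof.
rewrite -mulrDl -mulr2n -(rmorphMn scal) -mulr_natr mulVf //.
by rewrite rmorph1 mul1r.
Qed.

(** All four elements take nonzero values at the scalar point (0, 1, 1, -1), at
    which c0 = h0 = 0, g0 = -1 and b0 = 1. *)
Lemma seed_neq0 : [/\ g0 != 0, c - c0 * h0 != 0, b0 != 0 &
  c0 * c0 - b0 * c0 + g0 * g0 != 0].
Proof.
have [s [sP s_scal s_gen]] :=
  scalar_place freeD (fun i : 'I_4 => nth 0 [:: 0; 1; 1; -1] i).
have sb : s b 1 := s_gen 1.
have sc : s c 1 := s_gen 2.
have sd : s d (-1) := s_gen 3.
have sB x u y v w : s x u -> s y v -> w = u - v -> s (x - y) w.
  by move=> ? ? ->; apply: (placeB sP).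
have sM x u y v w : s x u -> s y v -> w = u * v -> s (x * y) w.
  by move=> ? ? ->; apply: (placeM sP).
have sD x u y v w : s x u -> s y v -> w = u + v -> s (x + y) w.
  by move=> ? ? ->; apply: (placeD sP).
have sV x u w : s x u -> u != 0 -> w = u^-1 -> s x^-1 w.
  by move=> ? ? ->; apply: (placeV sP).
have n0 := @place_neq0 _ _ _ sP.
have sc0 : s c0 0.
  by apply: sM (s_scal _) (sD _ _ _ _ _ sc sd erefl) _; rewrite subrr mulr0.
have sg0 : s g0 (-1) by apply: sB sc0 sc _; rewrite sub0r.
have N1 : (-1 : K) != 0 by rewrite oppr_eq0 oner_neq0.
have sh0 : s h0 0.
  by apply: sM (sV _ _ _ sg0 N1 erefl) (sB _ _ _ _ _ sb sc erefl) _; rewrite subrr mulr0.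
have sden : s (c - c0 * h0) 1.
  by apply: sB sc (sM _ _ _ _ _ sc0 sh0 erefl) _; rewrite mulr0 subr0.
have sgg : s (g0 * g0) 1 by apply: (sM _ _ _ _ _ sg0 sg0); rewrite mulrNN mulr1.
have scc : s (c0 * c0) 0 by apply: (sM _ _ _ _ _ sc0 sc0); rewrite mulr0.
have sb0 : s b0 1.
  apply: sM (sB _ _ _ _ _ (sM _ _ _ _ _ sc sc erefl)
    (sM _ _ _ _ _ (sD _ _ _ _ _ scc sgg erefl) sh0 erefl) erefl)
    (sV _ _ _ sden (oner_neq0 K) erefl) _.
  by rewrite mulr0 subr0 invr1 !mulr1.
have sn : s (c0 * c0 - b0 * c0 + g0 * g0) 1.
  apply: sD (sB _ _ _ _ _ scc (sM _ _ _ _ _ sb0 sc0 erefl) erefl) sgg _.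
  by rewrite mulr0 subr0 add0r.
by split; [apply: n0 sg0 _|apply: n0 sden _|apply: n0 sb0 _|apply: n0 sn _];
  rewrite ?oner_neq0.
Qed.

Let g := c - a.
Let n := (c - d) * c - C d b * (c - d).
Let rho_b := a + g * (n + g * g)^-1 * ((a - d) * a - C d b * (a - d)).

(** The point (c, b0, c0, t) of the field D((t; pi)), pi exchanging a and c,
    followed by t = 0. *)
Lemma degenerate_place : exists r : D -> D -> Prop,
  [/\ place r, forall t, r (scal t) (scal t), r a c & r c c0] /\
  [/\ r b b0, r d 0 & r (d * a * d^-1) a].
Proof.
have [pi [pi_scal pi_gen]] := involution_endo freeD (@tpermK _ (0 : 'I_4) 2).
have pic : pi c = a by rewrite pi_gen tpermR.
pose y (i : 'I_4) : series pi :=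
  nth 0 [:: serC pi c; serC pi b0; serC pi c0; serX pi] i.
have [h [hc hv]] := laurent_eval freeD pi_scal y.
pose lau := to_laurent pi Dfield.
have [s [sP s_fh]] := specialize freeD.1 h (@laurent_skew_field _ pi Dfield).
have sv i : s (gen f i) (lau (y i)) by have := s_fh (freeVar K i); rewrite hv.
have resP := place_residue pi Dfield.
have res := @residue_series _ pi Dfield.
exists (fun x z => exists2 u, s x u & residue u z); split; split.
- exact: place_comp sP resP.
- move=> t; exists (lau (serC pi (scal t))); last exact: res.
  by have := s_fh (freeConst 4 t); rewrite hc.
- by exists (lau (y 0)); [apply: sv | apply: res].
- by exists (lau (y 2)); [apply: sv | apply: res].
- by exists (lau (y 1)); [apply: sv | apply: res].
- by exists (lau (y 3)); [apply: sv | apply: res].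
have tau0 : lau (serX pi) != 0.
  apply/eqP; rewrite -(rmorph0 lau) => /to_laurent_inj.
  move/(congr1 (fun x : series pi => x 1%N))/eqP.
  by rewrite /serX oner_eq0.
exists (lau (serC pi a)); last exact: res.
have -> : lau (serC pi a) = lau (serX pi) * lau (serC pi c) * (lau (serX pi))^-1.
  by rewrite -rmorphM serX_C pic rmorphM mulrK // (@laurent_skew_field _ pi Dfield).
apply: (placeM sP); last by apply: (placeV sP) => //; apply: (sv 3).
by apply: (placeM sP); [apply: (sv 3) | apply: (sv 0)].
Qed.

Lemma twist_exists : exists sigma : {rmorphism D -> D},
  [/\ forall t, sigma (scal t) = scal t, sigma c = a, sigma d = c + g & sigma b = rho_b]
  /\ [/\ c != a, d != b, c != d & n + g * g != 0].
Proof.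
have [g00 den0 b00 n00] := seed_neq0.
have [r [[rP r_scal ra rc] [rb rd rad]]] := degenerate_place.
have neq0 := @place_neq0 _ _ _ rP.
have rg : r g g0 by apply: (placeB rP).
have rgg : r (g * g) (g0 * g0) by apply: (placeM rP).
have rCdb : r (C d b) b0.
  have <- : (0 - b0) * b0 * (0 - b0)^-1 = b0.
    by rewrite sub0r invrN mulrN !mulNr opprK mulrK // Dfield.
  have rdb : r (d - b) (0 - b0) by apply: (placeB rP).
  apply: (placeM rP); first by apply: (placeM rP).
  by apply: (placeV rP) => //; rewrite sub0r oppr_eq0.
have rcd : r (c - d) c0 by rewrite -[c0]subr0; apply: (placeB rP).
have rad' : r (a - d) c by rewrite -[c]subr0; apply: (placeB rP).
have rn : r (n + g * g) (c0 * c0 - b0 * c0 + g0 * g0).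
  apply: (placeD rP) => //.
  by apply: (placeB rP); apply: (placeM rP).
have rrho : r rho_b b.
  rewrite -[b](solve_root g00 den0 (erefl b0) n00).
  apply: (placeD rP) => //; apply: (placeM rP).
    by apply: (placeM rP) => //; apply: (placeV rP).
  by apply: (placeB rP); apply: (placeM rP).
have ng0 : n + g * g != 0 by apply: neq0 n00.
pose rho i := nth 0 [:: d * a * d^-1; rho_b; a; c + g] i.
have [i|sigma [sigma_scal sigma_gen]] :=
    endo_of_place freeD (rho := fun i : 'I_4 => rho i) rP r_scal.
  case: i => [[|[|[|[|//]]]] Hi].
  - by rewrite (_ : Ordinal Hi = 0) //; apply: val_inj.
  - by rewrite (_ : Ordinal Hi = 1) //; apply: val_inj.
  - by rewrite (_ : Ordinal Hi = 2) //; apply: val_inj.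
  rewrite (_ : Ordinal Hi = 3); last exact: val_inj.
  have -> : d = c0 + g0 by rewrite /g0 addrA c0_double addrC addKr.
  exact: (placeD rP).
exists sigma; split; last by split; rewrite ?(inj_eq (gen_inj freeD)).
by split; [| apply: (sigma_gen 2) | apply: (sigma_gen 3) | apply: (sigma_gen 1)].
Qed.

Lemma derivation_exists : exists (sigma : {rmorphism D -> D}) (delta : D -> D),
  [/\ forall x y, delta (x - y) = delta x - delta y,
      forall x y, delta (x * y) = delta x * sigma y + x * delta y,
      forall t, delta (scal t) = 0,
      {in [:: C b a; C (C a c) (C a b); C (C b d) (C b c); C c d],
        forall x, delta x = 0}
    & delta c != 0].
Proof.
have [sigma [[sigma_scal sc sd sb] [ca db cd ng0]]] := twist_exists.
have [delta [dB dM dscal dgen]] := twisted_derivation freeD sigma_scal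
  (fun i : 'I_4 => nth 0 [:: 0; 0; g; g + (c - d)] i).
have da : delta a = 0 := dgen 0.
have d_b : delta b = 0 := dgen 1.
have dc : delta c = g := dgen 2.
have dd : delta d = g + (c - d) := dgen 3.
exists sigma, delta; split=> //; last by rewrite dc subr_eq0.
move=> x; rewrite !inE => /or4P[] /eqP ->.
- exact: (delta_p_eq0 Dfield dB dM da d_b).
- exact: (@delta_q_eq0 _ sigma delta Dfield dB dM a).
- exact: (@delta_r_eq0 _ sigma delta Dfield dB dM a).
- exact: (@delta_s_eq0 _ sigma delta Dfield dB dM a).
Qed.

End FourGenerators.

(** * Rational expressions over a skew subfield *)

Lemma reval_in (K : fieldType) (n : nat) (D : unitRingType) (k : K -> D)
    (v : n.-tuple D) (P : {pred D}) :
  divring_closed P -> (forall t, k t \in P) -> (forall i, tnth v i \in P) ->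
  forall e x, reval k v e = Some x -> x \in P.
Proof.
move=> [P1 PB PV] Pk Pv.
have P0 : 0 \in P by rewrite -(subrr 1) PB.
have PN x : x \in P -> - x \in P by move=> Px; rewrite -sub0r PB.
have PI x : x \in P -> x^-1 \in P by move=> Px; rewrite -[_^-1]mul1r PV.
elim=> [t|i|e IHe|e IHe e' IHe'|e IHe e' IHe'|e IHe] x /=.
- by case=> <-.
- by case=> <-.
- by case: reval IHe => // y IHe [<-]; apply: PN; apply: IHe.
- case: reval IHe => // y IHe; case: reval IHe' => // y' IHe' [<-].
  by rewrite -[y']opprK PB ?PN ?(IHe _ erefl) ?(IHe' _ erefl).
- case: reval IHe => // y IHe; case: reval IHe' => // y' IHe' [<-].
  by rewrite -[y']invrK PV ?PI ?(IHe _ erefl) ?(IHe' _ erefl).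
by case: reval IHe => // y IHe; case: ifP => // _ [<-]; apply: PI; apply: IHe.
Qed.

Theorem theorem1p1 (K : fieldType) (charK : [pchar K] =i pred0)
    (D : unitRingType) (f : {rmorphism freeAlg K 4 -> D})
    (freeD : free_skew_field f) :
  let k := fun t : K => f (freeConst 4 t) in
  let a := f (freeVar K (0 : 'I_4)) in
  let b := f (freeVar K (1 : 'I_4)) in
  let c := f (freeVar K (2 : 'I_4)) in
  let d := f (freeVar K (3 : 'I_4)) in
  let p := C b a in
  let q := C (C a c) (C a b) in
  let r := C (C b d) (C b c) in
  let s := C c d in
  (exists x : D, ~ in_skew_subfield
     (fun y => (exists t : K, y = k t) \/ y \in [:: p; q; r; s]) x)
  /\
  ~ (exists ea eb ec ed : ratexpr K 4,
       [/\ reval k [tuple p; q; r; s] ea = Some a,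
           reval k [tuple p; q; r; s] eb = Some b,
           reval k [tuple p; q; r; s] ec = Some c
         & reval k [tuple p; q; r; s] ed = Some d]).
Proof.
move=> k a b c d p q r s.
have two_neq0 : 2%:R != 0 :> K by move: (charK 2%N); rewrite !inE /= => ->.
have Dfield : skew_field D := free_skew_field_skew freeD.
have [sigma [delta [dB dM dk dpqrs dc]]] := derivation_exists freeD two_neq0.
pose P : {pred D} := [pred x | delta x == 0].
have Pdiv : divring_closed P := kernel_divring_closed Dfield dB dM.
have Pk t : k t \in P by rewrite inE; apply/eqP/dk.
have Ppqrs y : y \in [:: p; q; r; s] -> y \in P by move/dpqrs/eqP.
have cP : c \notin P by [].
split; last first.
  move=> [ea [eb [ec [ed [_ _ ec_c _]]]]]; case/negP: cP.
  apply: (reval_in Pdiv Pk _ ec_c) => i; apply: Ppqrs; exact: mem_tnth.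
exists c => c_gen; case/negP: cP; apply: c_gen => // y [[t ->]|]; last exact: Ppqrs.
exact: Pk.
Qed.
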